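(* Let $h\le k\le n$ and $s$ be positive integers, let $\lambda$ be a partition of $h$ with at most $s$ parts, and let $\mu$ be a partition of $k$ with at most $s$ parts, such that either $h=k$ and $\lambda\le_{\mathrm{dom}}\mu$, or $h<k$ and $\lambda\subseteq\mu$. Then for each partition $\nu$ of $n$, $$[s_\nu]\,\mathrm{Frob}_q(R_{n,\lambda,s})\ \ge\ [s_\nu]\,\mathrm{Frob}_q(R_{n,\mu,s}),$$ where $[s_\nu]f$ is the coefficient of the Schur function $s_\nu$ in the Schur expansion of $f$, and the inequality is a coefficientwise comparison of two polynomials in $q$.
   Context: A partition $\lambda=(\lambda_1\ge\dots\ge\lambda_{\ell(\lambda)}>0)$ has length $\ell(\lambda)$; set $\lambda_i=0$ for $i>\ell(\lambda)$, and let $\lambda'_j=\#\{i:\lambda_i\ge j\}$ be the parts of the conjugate partition (with $\lambda'_j=0$ for large $j$). For partitions of the same integer, $\lambda\le_{\mathrm{dom}}\mu$ means $\lambda_1+\dots+\lambda_i\le\mu_1+\dots+\mu_i$ for all $i\le\ell(\lambda)$; $\lambda\subseteq\mu$ means $\lambda_i\le\mu_i$ for all $i$. Let $\mathbf{x}_n=\{x_1,\dots,x_n\}$; $S_n$ acts on $\mathbb{Q}[\mathbf{x}_n]$ by permuting variables. For $S\subseteq\mathbf{x}_n$ and $d\ge1$, $e_d(S)$ is the sum of all squarefree monomials of degree $d$ in the variables in $S$ (so $e_d(S)=0$ if $d>|S|$). For $0\le m\le n$ let $p^n_m(\lambda)=\lambda'_n+\lambda'_{n-1}+\dots+\lambda'_{n-m+1}$.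 Define $$I_{n,\lambda,s}=\langle x_i^s : 1\le i\le n\rangle+\langle e_d(S): S\subseteq\mathbf{x}_n,\ d>|S|-p^n_{|S|}(\lambda)\rangle,\qquad R_{n,\lambda,s}=\mathbb{Q}[\mathbf{x}_n]/I_{n,\lambda,s}.$$ $R_{n,\lambda,s}$ is a graded $S_n$-module (by polynomial degree). For a finite-dimensional $S_n$-module $V\cong\bigoplus_{\nu\vdash n}(S^\nu)^{c_\nu}$ ($S^\nu$ the irreducible module indexed by $\nu$), $\mathrm{Frob}(V)=\sum_\nu c_\nu s_\nu$; for a graded module $V=\bigoplus_i V_i$, $\mathrm{Frob}_q(V)=\sum_i q^i\,\mathrm{Frob}(V_i)$. *)

(* Defs.v *)
From HB Require Import structures.
From mathcomp Require Import all_boot all_order all_fingroup all_algebra.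
From mathcomp Require Import generic_quotient ring_quotient.
From mathcomp Require Import mxrepresentation character.
From mathcomp Require Import boolp.
From mathcomp Require Import mpoly.

Set Implicit Arguments.
Unset Strict Implicit.
Unset Printing Implicit Defensive.

Import GRing.Theory.
Local Open Scope nat_scope.

Definition is_intpart (n : nat) (la : seq nat) : bool :=
  [&& sorted geq la, 0 \notin la & sumn la == n].

Record intpart (n : nat) := IntPart {
  intpart_val :> seq nat;
  intpart_valP : is_intpart n intpart_val
}.

HB.instance Definition _ n := [isSub for @intpart_val n].
HB.instance Definition _ n := [Countable of intpart n by <:].

Lemma intpart_bound n (la : intpart n) i : i \in (la : seq nat) -> i <= n.
Proof.
case: la => /= la /and3P[_ _ /eqP <-]; elim: la => //= a la IH.
rewrite inE => /orP[/eqP->|/IH/leq_trans->//]; first exact: leq_addr.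
exact: leq_addl.
Qed.

Lemma size_intpart n (la : intpart n) : size la <= n.
Proof.
case: la => /= la /and3P[_ + /eqP <-]; elim: la => //= a la IH.
rewrite inE negb_or eq_sym -lt0n => /andP[a0 /IH le].
by rewrite -addn1 addnC leq_add.
Qed.

Definition intpart_code n (la : intpart n) : n.-bseq 'I_n.+1 :=
  insub_bseq n (map inord la).
Definition intpart_decode n (b : n.-bseq 'I_n.+1) : option (intpart n) :=
  insub (map val b).

Lemma intpart_codeK n : pcancel (@intpart_code n) (@intpart_decode n).
Proof.
move=> la; rewrite /intpart_code /intpart_decode /insub_bseq insubdK; last first.
  by rewrite unfold_in /= size_map size_intpart.
rewrite -map_comp map_id_in ?valK // => i /intpart_bound le.
by rewrite /= inordK.
Qed.

HB.instance Definition _ n :=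
  isFinite.Build (intpart n) (pcan_enumP (@intpart_codeK n)).

(* conj_part la j is the j-th column length of la, for j >= 1. *)
Definition conj_part (la : seq nat) (j : nat) : nat := count (leq j) la.

Definition dom_le (la mu : seq nat) : Prop :=
  forall i, i <= size la -> sumn (take i la) <= sumn (take i mu).

Definition part_incl (la mu : seq nat) : Prop :=
  forall i, nth 0 la i <= nth 0 mu i.

(* la'_n + la'_{n-1} + ... + la'_{n-m+1} *)
Definition tail_cols (n m : nat) (la : seq nat) : nat :=
  \sum_((n - m).+1 <= j < n.+1) conj_part la j.

Section Specht.
Variables (n : nat) (nu : intpart n).

(* The canonical tableau of shape nu is filled row by row with 0, ..., n.-1;
   entry i lies in row [reshape_index nu i] and column [reshape_offset nu i]. *)
Definition row_stab : {set 'S_n} :=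
  [set t : 'S_n | [forall i : 'I_n, reshape_index nu (t i) == reshape_index nu i]].
Definition col_stab : {set 'S_n} :=
  [set t : 'S_n | [forall i : 'I_n, reshape_offset nu (t i) == reshape_offset nu i]].

Local Open Scope ring_scope.

Definition young_symmetrizer : 'rV[rat]_#|[set: 'S_n]| :=
  \sum_(a in row_stab) \sum_(b in col_stab)
    (-1) ^+ odd_perm b *: delta_mx 0 (gring_index [set: 'S_n]%G (a * b)%g).

(* The right ideal of Q[S_n] generated by the Young symmetrizer, as a
   submodule of the right regular representation. *)
Definition specht : representation rat [set: 'S_n]%G :=
  Representation (submod_repr
    (cyclic_mx_module (regular_repr rat [set: 'S_n]%G) young_symmetrizer)).

End Specht.

Local Open Scope ring_scope.
Local Open Scope quotient_scope.

Section Ideal.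
Variables (n : nat) (gens : {mpoly rat[n]} -> Prop).
Implicit Types p q : {mpoly rat[n]}.

Definition ideal_gen : {pred {mpoly rat[n]}} := fun p =>
  `[< exists2 r : seq ({mpoly rat[n]} * {mpoly rat[n]}),
        (forall x, x \in r -> gens x.2) & p = \sum_(x <- r) x.1 * x.2 >].

Lemma ideal_genMD a p q :
  p \in ideal_gen -> q \in ideal_gen -> a * p + q \in ideal_gen.
Proof.
move=> /asboolP[r rG ->] /asboolP[t tG ->]; apply/asboolP.
exists ([seq (a * x.1, x.2) | x <- r] ++ t).
  by move=> x; rewrite mem_cat => /orP[/mapP[y /rG yG ->]//|/tG].
rewrite big_cat big_map /= mulr_sumr; congr (_ + _).
by apply: eq_bigr => x _; rewrite mulrA.
Qed.

Lemma ideal_gen0 : 0 \in ideal_gen.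
Proof. by apply/asboolP; exists [::]; rewrite ?big_nil. Qed.

Lemma ideal_gen_zmod_closed : zmod_closed ideal_gen.
Proof.
split; first exact: ideal_gen0.
by move=> p q pI qI; rewrite addrC -mulN1r ideal_genMD.
Qed.

HB.instance Definition _ :=
  GRing.isZmodClosed.Build {mpoly rat[n]} ideal_gen ideal_gen_zmod_closed.

Lemma ideal_genM a p : p \in ideal_gen -> a * p \in ideal_gen.
Proof. by move=> pI; rewrite -[_ * _]addr0 ideal_genMD ?ideal_gen0. Qed.

Definition quo : Type := {ideal_quot ideal_gen}.
HB.instance Definition _ :=
  ZmodQuotient.copy quo {ideal_quot ideal_gen}.

Lemma quo_eqP p q : reflect (\pi_quo p = \pi_quo q) (p - q \in ideal_gen).
Proof. by rewrite Quotient.idealrBE; apply: eqP. Qed.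

Definition quo_scale (c : rat) (x : quo) : quo := \pi_quo (c *: repr x).

Lemma quo_scale_pi c p : quo_scale c (\pi_quo p) = \pi_quo (c *: p).
Proof.
apply/quo_eqP; rewrite -scalerBr -mul_mpolyC ideal_genM //.
exact/quo_eqP/reprK.
Qed.

Lemma quo_scaleA a b x : quo_scale a (quo_scale b x) = quo_scale (a * b) x.
Proof. by elim/quotW: x => p; rewrite (quo_scale_pi b) !quo_scale_pi scalerA. Qed.
Lemma quo_scale1 : left_id 1 quo_scale.
Proof. by elim/quotW=> p; rewrite quo_scale_pi scale1r. Qed.
Lemma quo_scaleDr : right_distributive quo_scale +%R.
Proof.
move=> a; elim/quotW=> p; elim/quotW=> q.
by rewrite -raddfD !quo_scale_pi scalerDr raddfD.
Qed.
Lemma quo_scaleDl x : {morph quo_scale^~ x : a b / a + b}.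
Proof.
by move=> a b; elim/quotW: x => p; rewrite !quo_scale_pi scalerDl raddfD.
Qed.

HB.instance Definition _ := GRing.Zmodule_isLmodule.Build rat quo
  quo_scaleA quo_scale1 quo_scaleDr quo_scaleDl.

(* The action induced by x_i |-> x_(g i); it does not depend on the chosen
   representative when gens is stable under permutations, see quo_act_pi. *)
Definition quo_act (g : 'S_n) (x : quo) : quo := \pi_quo (msym g (repr x)).

Lemma quo_act_pi (g : 'S_n) p :
  (forall q, gens q -> gens (msym g q)) ->
  quo_act g (\pi_quo p) = \pi_quo (msym g p).
Proof.
move=> sG; apply/quo_eqP; rewrite -msymB.
have /asboolP[r rG ->] : repr (\pi_quo p) - p \in ideal_gen.
  exact/quo_eqP/reprK.
apply/asboolP; exists [seq (msym g x.1, msym g x.2) | x <- r].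
  by move=> x /mapP[y /rG/sG yG ->].
by rewrite raddf_sum big_map; apply: eq_bigr => x _; apply: msymM.
Qed.

Definition quo_deg (d : nat) (x : quo) : Prop :=
  exists2 p : {mpoly rat[n]}, p \is d.-homog & x = \pi_quo p.

(* rG is isomorphic, as an S_n-module, to the degree d component of quo. *)
Definition deg_iso (d : nat) (rG : representation rat [set: 'S_n]%G) : Prop :=
  exists f : {linear 'rV[rat]_(rdegree rG) -> quo},
    [/\ injective f,
        forall x, quo_deg d x <-> exists v, x = f v
      & forall g v, f (v *m rG g) = quo_act g (f v)].

(* Homogeneous symmetric functions of degree n are given by their coordinates
   in the Schur basis, with coefficients in N[q]: F nu is [s_nu] F. *)
Definition is_Frobq (F : intpart n -> {poly nat}) : Prop :=
  forall d, deg_iso d (\big[dadd_grepr/grepr0]_(nu : intpart n)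
                          muln_grepr (specht nu) ((F nu)`_d)%R).

End Ideal.

Section Rnls.
Variables (n : nat) (la : seq nat) (s : nat).

Definition elem_sym (d : nat) (S : {set 'I_n}) : {mpoly rat[n]} :=
  \sum_(T : {set 'I_n} | (T \subset S) && (#|T| == d)) \prod_(i in T) 'X_i.

(* The condition d > |S| - p is written without truncated subtraction. *)
Definition gens_nls (p : {mpoly rat[n]}) : Prop :=
  (exists i : 'I_n, p = 'X_i ^+ s) \/
  (exists (S : {set 'I_n}) (d : nat),
     [/\ (1 <= d)%N, (#|S| < d + tail_cols n #|S| la)%N & p = elem_sym d S]).

Lemma msym_var (g : 'S_n) (i : 'I_n) : msym g 'X_i = 'X_(g i) :> {mpoly rat[n]}.
Proof.
rewrite msymX; congr 'X_[_]; apply/mnmP => j.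
by rewrite mnmE !mnm1E -(inj_eq (@perm_inj _ g)) permKV.
Qed.

Lemma gens_nls_msym (g : 'S_n) p : gens_nls p -> gens_nls (msym g p).
Proof.
case=> [[i ->]|[S [d [d1 Sd ->]]]]; [left|right].
  by exists (g i); rewrite rmorphXn /= msym_var.
have cg (T : {set 'I_n}) : #|g @: T| = #|T| by rewrite card_imset //; apply: perm_inj.
have sg (T : {set 'I_n}) : (g @: T \subset g @: S) = (T \subset S).
  apply/idP/idP => [/subsetP sTS|]; last exact: imsetS.
  apply/subsetP => i iT; have := sTS (g i) (imset_f g iT).
  by rewrite mem_imset //; apply: perm_inj.
exists (g @: S), d; split; rewrite ?cg //.
rewrite /elem_sym raddf_sum /= [RHS](reindex (fun T : {set 'I_n} => g @: T)) /=.
  apply: eq_big => [T|T _]; first by rewrite cg sg.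
  rewrite rmorph_prod /= big_imset /=; last by move=> ? ? _ _; apply: perm_inj.
  by apply: eq_bigr => i _; rewrite msym_var.
exists (fun T : {set 'I_n} => (g^-1)%g @: T) => T _; rewrite -imset_comp -[RHS]imset_id.
  by apply: eq_imset => i /=; rewrite permK.
by apply: eq_imset => i /=; rewrite permKV.
Qed.

(* quo gens_nls is the ring R_{n,la,s}. *)
Definition is_Frobq_R : (intpart n -> {poly nat}) -> Prop := is_Frobq gens_nls.

End Rnls.

Arguments is_Frobq_R : clear implicits.

(* Main.v *)
From HB Require Import structures.
Require Import Defs.
From mathcomp Require Import all_boot all_order all_fingroup all_algebra.
From mathcomp Require Import generic_quotient.
From mathcomp Require Import mxrepresentation character.
From mathcomp Require Import boolp mpoly zify.

Set Implicit Arguments.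
Unset Strict Implicit.
Unset Printing Implicit Defensive.

Import GRing.Theory Num.Theory.

(** The number of boxes of [la] in the last [m] of [n] columns is
    [\sum_i (la_i - N)] with [N = n - m] and truncated subtraction
    ([tail_colsE]). This sum is monotone for inclusion and for dominance
    ([leq_tail_cols]), so the generators of the ideal for [la] are among those
    for [mu], and the ring for [la] maps equivariantly onto the ring for [mu],
    degree by degree ([deg_iso_epi]).

    It remains to compare the multiplicities of Specht modules in two direct
    sums, the second being an equivariant image of the first
    ([leq_specht_mult]). Neither irreducibility nor complete reducibility is
    needed. The rank [young_rank nu V] of the Young symmetrizer [c_nu] acting on
    [V] is additive on direct sums and does not increase under surjections, so it
    suffices that it is positive on the Specht module of [nu] and zero on the
    others ([young_rank_specht]):
    - [c_la g c_mu = 0] for [la <> mu] and every permutation [g]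
      ([young_op_orth]). If some row sum, permutation and column sum have a
      nonzero product, then no transposition can be absorbed on both sides with
      opposite signs, and a count of boxes shows that one shape dominates the
      other. A nonzero [c_la g c_mu] gives dominance both ways, hence
      [la = mu].
    - [c_nu] does not annihilate [c_nu Q[S_n]], by positivity of the form
      [x |-> coefficient of 1 in x x'], where [x'] is the image of [x] under
      inversion of the group elements ([young_op_specht_neq0]). *)

Local Open Scope nat_scope.

(** * Column lengths and dominance *)

Lemma intpart_sorted n (la : intpart n) : sorted geq la.
Proof. by case: la => /= la /and3P[]. Qed.

Lemma sumn_intpart n (la : intpart n) : sumn la = n.
Proof. by case: la => /= la /and3P[_ _ /eqP]. Qed.

Lemma intpart_gt0 n (la : intpart n) i : i < size la -> 0 < nth 0 la i.
Proof.
case: la => /= la /and3P[_ la0 _] ltis; rewrite lt0n.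
by apply: contra la0 => /eqP <-; apply: mem_nth.
Qed.

Lemma leq_nth_intpart n (la : intpart n) i j :
  i <= j -> nth 0 la j <= nth 0 la i.
Proof.
move=> leij; have [ltj|lej] := ltnP j (size la); last by rewrite nth_default.
have tr : transitive geq by move=> a b c; rewrite /geq /= => ba cb; lia.
have rfl : reflexive geq by move=> a; rewrite /geq /=.
apply: (sorted_leq_nth tr rfl 0 (intpart_sorted la)); rewrite ?inE //.
exact: leq_ltn_trans ltj.
Qed.

Lemma leq_sumn_take (s : seq nat) k l :
  k <= l -> sumn (take k s) <= sumn (take l s).
Proof.
move=> lekl; rewrite -(subnKC lekl) takeD sumn_cat; exact: leq_addr.
Qed.

(** A row of length [x <= n] has [x - (n - m)] boxes in the last [m] of [n]
    columns. *)
Lemma tail_colsE n m (la : seq nat) : (forall x, x \in la -> x <= n) ->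
  tail_cols n m la = \sum_(x <- la) (x - (n - m)).
Proof.
move=> bnd; rewrite /tail_cols /conj_part.
under eq_bigr => j _ do rewrite -sum1_count big_mkcond.
rewrite exchange_big /= [LHS]big_seq [RHS]big_seq; apply: eq_bigr => x /bnd lexn.
rewrite -big_mkcond /=.
have := @big_nat_widen _ 0 addn (n - m).+1 x.+1 n.+1 xpredT (fun=> 1) lexn.
by rewrite /= => <-; rewrite sum_nat_const_nat muln1 subSS.
Qed.

Lemma leq_sum_excess (la : seq nat) k N :
  sumn (take k la) <= \sum_(x <- la) (x - N) + k * N.
Proof.
elim: la k => [|x la IH] [|k] //=.
rewrite big_cons mulSn; have := IH k; lia.
Qed.

(** For a decreasing sequence, the bound of [leq_sum_excess] is attained by the
    number [k] of terms exceeding [N]. *)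
Lemma sum_excess_attained (la : seq nat) N : sorted geq la ->
  exists2 k, k <= size la & \sum_(x <- la) (x - N) + k * N <= sumn (take k la).
Proof.
elim: la => [|x la IH] /= sla; first by exists 0; rewrite ?big_nil.
have [lexN|ltNx] := leqP x N; last first.
  have [k lek Hk] := IH (path_sorted sla).
  by exists k.+1 => //=; rewrite big_cons mulSn; lia.
exists 0 => //=; rewrite addn0 leqn0 sum_nat_seq_eq0 /= subn_eq0 lexN /=.
apply/allP => y yla; rewrite subn_eq0.
have tr : transitive geq by move=> a b c; rewrite /geq /= => ba cb; lia.
have /allP/(_ y yla) := order_path_min tr sla.
by move=> /leq_trans; apply.
Qed.

Lemma dom_le_sum_excess (la mu : seq nat) N : sorted geq la -> dom_le la mu ->
  \sum_(x <- la) (x - N) <= \sum_(x <- mu) (x - N).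
Proof.
move=> sla dom; have [k lek Hk] := sum_excess_attained N sla.
have := dom k lek; have := leq_sum_excess mu k N; lia.
Qed.

Lemma part_incl_sum_excess (la mu : seq nat) N : part_incl la mu ->
  \sum_(x <- la) (x - N) <= \sum_(x <- mu) (x - N).
Proof.
elim: la mu => [|x la IH] mu incl; first by rewrite big_nil.
rewrite big_cons; have := incl 0; case: mu incl => [|y mu] incl /= lexy.
  have /IH : part_incl la [::] by move=> i; have := incl i.+1; rewrite !nth_nil.
  rewrite big_nil; lia.
have := IH mu (fun i => incl i.+1); rewrite big_cons; lia.
Qed.

(** * Rows and columns of the canonical tableau *)

Lemma reshape_index_lt sh i k : i < sumn sh ->
  (reshape_index sh i < k) = (i < sumn (take k sh)).
Proof.
move=> lti; have rK := reshape_indexK sh i.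
have ltr := reshape_indexP lti; have lto := reshape_offsetP lti.
move: rK; rewrite /flatten_index => rK; rewrite -[in RHS]rK.
have [ltrk|lekr] := ltnP (reshape_index sh i) k.
  apply/esym/leq_trans/(leq_sumn_take sh ltrk).
  by rewrite (take_nth 0) // sumn_rcons ltn_add2l.
apply/esym/negbTE; rewrite -leqNgt.
by apply: leq_trans (leq_sumn_take sh lekr) _; apply: leq_addr.
Qed.

Lemma card_rows_lt n (la : intpart n) k :
  #|[set i : 'I_n | reshape_index la i < k]| = sumn (take k la).
Proof.
have le_n : sumn (take k la) <= n.
  rewrite -[leqRHS](sumn_intpart la) -{2}(take_size la).
  have [lek|ltk] := leqP k (size la); first exact: leq_sumn_take.
  by rewrite !take_oversize // ltnW.
have -> : [set i : 'I_n | reshape_index la i < k] =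
          [set widen_ord le_n i | i in 'I_(sumn (take k la))].
  apply/setP => i; rewrite inE reshape_index_lt ?sumn_intpart //.
  apply/idP/imsetP => [lti|[j _ ->]]; last exact: (ltn_ord j).
  by exists (Ordinal lti) => //; apply: val_inj.
by rewrite card_imset ?card_ord // => i j /(congr1 val) /= /val_inj.
Qed.

Lemma reshape_inj n (la : intpart n) (i j : 'I_n) :
  reshape_index la i = reshape_index la j ->
  reshape_offset la i = reshape_offset la j -> i = j.
Proof.
move=> ri ro; apply: val_inj; rewrite /= -(reshape_indexK la i) ri ro.
exact: reshape_indexK.
Qed.

(** If [g] sends the boxes of each row of [la] into different columns of [mu],
    then [la] is dominated by [mu]: the first [k] rows of [la] put at most [k]
    boxes into each column of [mu], so no more than its first [k] rows hold. *)
Lemma row_col_transversal_dom n (la mu : intpart n) (g : 'S_n) :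
  (forall i j : 'I_n, reshape_index la i = reshape_index la j ->
     reshape_offset mu (g i) = reshape_offset mu (g j) -> i = j) ->
  forall k, sumn (take k la) <= sumn (take k mu).
Proof.
move=> inj k; rewrite -!card_rows_lt -[leqLHS]sum1_card -[leqRHS]sum1_card.
have ltc (i : 'I_n) : reshape_offset mu i < n by apply: leq_ltn_trans (leq_subr _ _) _.
pose c (i : 'I_n) := Ordinal (ltc i).
rewrite (partition_big (c \o g) xpredT) //= [leqRHS](partition_big c xpredT) //=.
apply: leq_sum => j _; rewrite !sum1dep_card.
set A := [set _ | _]; set B := [set _ | _].
have AP i : i \in A -> reshape_index la i < k /\ reshape_offset mu (g i) = j.
  by rewrite !inE => /andP[-> /eqP <-].
case: k @A @B AP => [|k] A B AP.
  by rewrite (_ : A = set0) ?cards0 //; apply/setP => i; rewrite !inE.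
(* Counting from 0, if row k of mu reaches column j, then so do the rows above it, and both
   sides are compared with k.+1; otherwise column j of mu lies in the first k
   rows. *)
have [ltj|lej] := ltnP j (nth 0 mu k).
  have ltx (x : 'I_k.+1) : j < nth 0 mu x.
    by apply: leq_trans ltj (leq_nth_intpart _ _); rewrite -ltnS.
  have ltf (x : 'I_k.+1) : flatten_index mu x j < n.
    by rewrite -[ltnRHS](sumn_intpart mu) flatten_indexP.
  pose f x := Ordinal (ltf x).
  have finj : injective f.
    move=> x y /(congr1 (fun i => reshape_index mu (val i))) /=.
    by rewrite !flatten_indexKl // => /val_inj.
  apply: (@leq_trans k.+1); last first.
    rewrite -{1}[k.+1]card_ord -(card_imset _ finj); apply: subset_leq_card.
    apply/subsetP => _ /imsetP[x _ ->].
    by rewrite !inE /= flatten_indexKl // ltn_ord -val_eqE /= flatten_indexKr /=.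
  pose r (i : 'I_n) : 'I_k.+1 := inord (reshape_index la i).
  have rinj : {in A &, injective r}.
    move=> x y /AP[xr xc] /AP[yr yc] /(congr1 val).
    by rewrite /= !inordK // => /inj; apply; rewrite xc yc.
  rewrite -(card_in_imset rinj); apply: leq_trans (max_card _) _.
  by rewrite card_ord.
rewrite -(card_imset _ (@perm_inj _ g)); apply: subset_leq_card.
apply/subsetP => _ /imsetP[x /[dup] xA /AP[_ xc] ->].
move: xA; rewrite !inE /= => /andP[_ ->]; rewrite andbT.
rewrite ltnNge; apply/negP => ltk.
have ltg : (g x) < sumn mu by rewrite sumn_intpart.
have := reshape_offsetP ltg; rewrite xc ltnNge.
by rewrite (leq_trans (leq_nth_intpart _ (ltnW ltk))).
Qed.

Lemma intpart_eq_take n (la mu : intpart n) :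
  (forall k, sumn (take k la) = sumn (take k mu)) -> la = mu.
Proof.
move=> eq_take.
have eq_nth i : nth 0 la i = nth 0 mu i.
  have sumS (s : seq nat) : sumn (take i.+1 s) = sumn (take i s) + nth 0 s i.
    have [lti|lei] := ltnP i (size s); first by rewrite (take_nth 0) // sumn_rcons.
    by rewrite !take_oversize ?nth_default ?addn0 // ltnW.
  by have := eq_take i.+1; rewrite !sumS eq_take => /addnI.
have size_le (a b : intpart n) : (forall i, nth 0 a i = nth 0 b i) -> size a <= size b.
  move=> ab; rewrite leqNgt; apply/negP => /intpart_gt0.
  by rewrite ab nth_default.
apply/val_inj/(@eq_from_nth _ 0) => [|i _]; last exact: eq_nth.
by apply/anti_leq; rewrite !size_le.
Qed.

Local Open Scope ring_scope.

(** * Young symmetrizers acting on representations *)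

Section Symmetrizers.
Variables (n m : nat) (rG : mx_representation rat [set: 'S_n]%G m).
Implicit Types (f h : 'I_n -> nat) (t g : 'S_n) (e : bool).

(** The permutations preserving the fibres of [f]. *)
Definition fibre_stab f : {set 'S_n} :=
  [set t : 'S_n | [forall i : 'I_n, f (t i) == f i]].

(** The operator of [rG] given by the sum of the elements of [fibre_stab f],
    weighted by their signs when [e] is true. *)
Definition fibre_sum f e : 'M[rat]_m :=
  \sum_(t in fibre_stab f) (-1) ^+ (e && odd_perm t) *: rG t.

Lemma fibre_stabP f t : reflect (forall i, f (t i) = f i) (t \in fibre_stab f).
Proof. by rewrite inE; apply: (iffP forallP) => H i; apply/eqP/H. Qed.

Lemma fibre_stabMr f t g : t \in fibre_stab f ->
  ((g * t)%g \in fibre_stab f) = (g \in fibre_stab f).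
Proof.
move=> /fibre_stabP tf.
by apply/fibre_stabP/fibre_stabP => H i; move: (H i); rewrite permM tf.
Qed.

Lemma fibre_stabMl f t g : t \in fibre_stab f ->
  ((t * g)%g \in fibre_stab f) = (g \in fibre_stab f).
Proof.
move=> /fibre_stabP tf; apply/fibre_stabP/fibre_stabP => H i.
  have := H ((t^-1)%g i); rewrite permM permKV => ->.
  by rewrite -{2}[i](permKV t) tf.
by rewrite permM H tf.
Qed.

Lemma tperm_fibre_stab f i j : f i = f j -> tperm i j \in fibre_stab f.
Proof. by move=> fij; apply/fibre_stabP => l; case: tpermP => [->|->|]. Qed.

Lemma fibre_sum_tperm f e i j : i != j -> f i = f j ->
  fibre_sum f e = (-1) ^+ e *: (fibre_sum f e *m rG (tperm i j)).
Proof.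
move=> neq_ij fij; rewrite {1}/fibre_sum (reindex_inj (mulIg (tperm i j))) /=.
rewrite mulmx_suml scaler_sumr; apply: eq_big => [t|t _].
  by rewrite fibre_stabMr // tperm_fibre_stab.
rewrite repr_mxM ?inE // -scalemxAl scalerA odd_permM odd_tperm neq_ij addbT.
by case: e; case: odd_perm; rewrite /= ?expr0 ?expr1 ?mul1r ?mulrN1 ?opprK.
Qed.

Lemma tperm_fibre_sum f e i j : i != j -> f i = f j ->
  fibre_sum f e = (-1) ^+ e *: (rG (tperm i j) *m fibre_sum f e).
Proof.
move=> neq_ij fij; rewrite {1}/fibre_sum (reindex_inj (mulgI (tperm i j))) /=.
rewrite mulmx_sumr scaler_sumr; apply: eq_big => [t|t _].
  by rewrite fibre_stabMl // tperm_fibre_stab.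
rewrite repr_mxM ?inE // -scalemxAr scalerA odd_permM odd_tperm neq_ij addTb.
by case: e; case: odd_perm; rewrite /= ?expr0 ?expr1 ?mul1r ?mulrN1 ?opprK.
Qed.

(** A transposition preserving the fibres of [f], whose conjugate by [g]
    preserves those of [h], can be absorbed by either sum, with opposite
    signs. *)
Lemma fibre_sum_mul0 f h e g i j : i != j -> f i = f j -> h (g i) = h (g j) ->
  fibre_sum f e *m rG g *m fibre_sum h (~~ e) = 0.
Proof.
move=> neq_ij fij hij; set X := LHS.
have neq_gij : g i != g j by rewrite (inj_eq perm_inj).
have absorb : rG (tperm (g i) (g j)) *m fibre_sum h (~~ e) =
              (-1) ^+ (~~ e) *: fibre_sum h (~~ e).
  by rewrite [in RHS](tperm_fibre_sum (~~ e) neq_gij hij) scalerA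
     -signr_addb addbb scale1r.
have XN : X = - X.
  rewrite {1}/X (fibre_sum_tperm e neq_ij fij) -!scalemxAl.
  rewrite -[_ *m rG _ *m rG g]mulmxA -repr_mxM ?inE // conjgC tpermJ.
  rewrite repr_mxM ?inE // mulmxA -(mulmxA (_ *m rG g)) absorb -scalemxAr scalerA -/X.
  by rewrite -signr_addb addbN addbb scaleN1r.
apply/matrixP => a b; have E : - X a b = X a b by rewrite [in RHS]XN [RHS]mxE.
by apply/eqP; rewrite [X in _ == X]mxE -eqNr E.
Qed.

Lemma sandwich_fibre_sum0 p q (A : 'M_(p, m)) (B : 'M_(m, q)) f h e e' g :
  (forall x : 'S_n, A *m rG x *m B = 0) ->
  A *m (fibre_sum f e *m rG g *m fibre_sum h e') *m B = 0.
Proof.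
move=> AB0; rewrite /fibre_sum !mulmx_suml mulmx_sumr mulmx_suml big1 // => a _.
rewrite 2!mulmx_sumr mulmx_suml big1 // => b _.
by rewrite -!(scalemxAl, scalemxAr) -!repr_mxM ?inE // AB0 !scaler0.
Qed.

Variable nu : intpart n.

(** The row and the column of the box filled with [i] in the canonical tableau
    of shape [la]. *)
Definition box_row (la : intpart n) (i : 'I_n) := reshape_index la i.
Definition box_col (la : intpart n) (i : 'I_n) := reshape_offset la i.

(** The action of the Young symmetrizer of [nu] on [rG]. *)
Definition young_op : 'M[rat]_m :=
  fibre_sum (box_row nu) false *m fibre_sum (box_col nu) true.

Lemma young_opE : young_op =
  \sum_(a in row_stab nu) \sum_(b in col_stab nu) (-1) ^+ odd_perm b *: rG (a * b)%g.
Proof.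
rewrite /young_op {1}/fibre_sum mulmx_suml; apply: eq_bigr => a _.
rewrite /= expr0 scale1r mulmx_sumr; apply: eq_bigr => b _.
by rewrite -scalemxAr repr_mxM ?inE.
Qed.

End Symmetrizers.

(** A nonzero product of a row sum, a permutation and a column sum forces the
    hypothesis of [row_col_transversal_dom]. *)
Lemma fibre_sum_dom n m (rG : mx_representation rat [set: 'S_n]%G m)
    (la mu : intpart n) (g : 'S_n) :
    fibre_sum rG (box_row la) false *m rG g *m fibre_sum rG (box_col mu) true != 0 ->
  forall k, (sumn (take k la) <= sumn (take k mu))%N.
Proof.
move=> nz; apply: (@row_col_transversal_dom n la mu g) => i j ri ci.
apply: contraNeq nz => neq_ij; apply/eqP.
exact: fibre_sum_mul0 neq_ij ri ci.
Qed.

Lemma fibre_sum_domC n m (rG : mx_representation rat [set: 'S_n]%G m)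
    (la mu : intpart n) (g : 'S_n) :
    fibre_sum rG (box_col la) true *m rG g *m fibre_sum rG (box_row mu) false != 0 ->
  forall k, (sumn (take k mu) <= sumn (take k la))%N.
Proof.
move=> nz; apply: (@row_col_transversal_dom n mu la g^-1) => i j ri ci.
apply: contraNeq nz => neq_ij; apply/eqP.
apply: (@fibre_sum_mul0 _ _ _ _ _ true _ ((g^-1)%g i) ((g^-1)%g j)) => //.
  by rewrite (inj_eq perm_inj).
by rewrite /box_row !permKV.
Qed.

Lemma young_op_orth n m (rG : mx_representation rat [set: 'S_n]%G m)
    (la mu : intpart n) (g : 'S_n) : la != mu ->
  young_op rG la *m rG g *m young_op rG mu = 0.
Proof.
apply: contraNeq => nz; apply/eqP/intpart_eq_take => k; apply/anti_leq/andP; split.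
  (* Expanding the two inner sums of c_la g c_mu, some product of the row sum
     of la, a permutation x and the column sum of mu is nonzero. *)
  have [x] : exists x : 'S_n,
      fibre_sum rG (box_row la) false *m rG x *m fibre_sum rG (box_col mu) true != 0.
    apply/existsP; apply: contraNT nz; rewrite negb_exists => /forallP z.
    have -> : young_op rG la *m rG g *m young_op rG mu =
        fibre_sum rG (box_row la) false *m
        (fibre_sum rG (box_col la) true *m rG g *m fibre_sum rG (box_row mu) false)
        *m fibre_sum rG (box_col mu) true by rewrite /young_op !mulmxA.
    by rewrite sandwich_fibre_sum0 // => x; apply/eqP/negbNE/z.
  by move/fibre_sum_dom; apply.
apply: (@fibre_sum_domC _ _ rG la mu g).
apply: contraNneq nz => z; rewrite /young_op !mulmxA -(mulmxA _ _ (rG g)).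
by rewrite -(mulmxA _ (_ *m rG g)) z mulmx0 mul0mx.
Qed.

(** * The rank of a Young symmetrizer *)

Section YoungRank.
Variables (n : nat) (nu : intpart n).
Implicit Types rG : representation rat [set: 'S_n]%G.

(** The rank of the Young symmetrizer of [nu] on [rG]. On a direct sum of
    Specht modules it is proportional to the multiplicity of [specht nu]. *)
Definition young_rank rG : nat := \rank (young_op rG nu).

Lemma young_rank0 : young_rank grepr0 = 0%N.
Proof. by apply/eqP; rewrite -leqn0 rank_leq_row. Qed.

Lemma young_rankD rG1 rG2 :
  young_rank (dadd_grepr rG1 rG2) = (young_rank rG1 + young_rank rG2)%N.
Proof.
rewrite /young_rank -rank_diag_block_mx !young_opE; congr (\rank _).
pose D := fun A => block_mx A.1 0 0 A.2 : 'M[rat]_(rdegree rG1 + rdegree rG2).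
have sumD (I : Type) (r : seq I) (P : pred I) (A1 : I -> 'M[rat]_(rdegree rG1))
    (A2 : I -> 'M[rat]_(rdegree rG2)) :
  \sum_(i <- r | P i) block_mx (A1 i) 0 0 (A2 i) =
    block_mx (\sum_(i <- r | P i) A1 i) 0 0 (\sum_(i <- r | P i) A2 i).
  elim/big_rec3: _ => [|i A B C _ ->]; first by rewrite block_mx0.
  by rewrite add_block_mx !addr0.
rewrite -sumD; apply: eq_bigr => a _; rewrite -sumD; apply: eq_bigr => b _.
by rewrite scale_block_mx !scaler0.
Qed.

Lemma young_rank_sum (I : Type) (r : seq I) (P : pred I)
    (rG : I -> representation rat [set: 'S_n]%G) :
  young_rank (\big[dadd_grepr/grepr0]_(i <- r | P i) rG i) =
  (\sum_(i <- r | P i) young_rank (rG i))%N.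
Proof.
elim/big_rec2: _ => [|i k rH _ <-]; first exact: young_rank0.
exact: young_rankD.
Qed.

Lemma young_rank_muln rG k : young_rank (muln_grepr rG k) = (k * young_rank rG)%N.
Proof. by rewrite young_rank_sum sum_nat_const card_ord. Qed.

(** The rank can only drop under an equivariant surjection [T]. *)
Lemma young_rank_epi rG1 rG2 (T : 'M_(rdegree rG1, rdegree rG2)) :
    row_full T -> (forall g : 'S_n, T *m rG2 g = rG1 g *m T) ->
  (young_rank rG2 <= young_rank rG1)%N.
Proof.
move=> fullT TJ; rewrite /young_rank -(eqmxMfull (young_op rG2 nu) fullT).
have -> : T *m young_op rG2 nu = young_op rG1 nu *m T.
  rewrite !young_opE mulmx_sumr mulmx_suml; apply: eq_bigr => a _.
  rewrite mulmx_sumr mulmx_suml; apply: eq_bigr => b _.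
  by rewrite -scalemxAl -scalemxAr TJ.
exact: mxrankM_maxl.
Qed.

End YoungRank.

(** * Specht modules *)

Section RegularRepresentation.
Variable n : nat.
Local Notation G := [set: 'S_n]%G.
Local Notation aG := (regular_repr rat G).
Local Notation idx := (gring_index G).

Lemma regular_repr_delta (x y : 'S_n) :
  delta_mx 0 (idx x) *m aG y = delta_mx 0 (idx (x * y)%g) :> 'rV_#|G|.
Proof. by rewrite -rowE rowK gring_indexK ?inE. Qed.

Lemma tr_regular_repr (g : 'S_n) : (aG g)^T = aG (g^-1)%g.
Proof.
apply/matrixP => i j; rewrite !mxE /= -[in LHS](gring_valK i) -[in RHS](gring_valK j).
rewrite !(inj_in_eq (can_in_inj (@gring_indexK _ G))) ?inE //.
by rewrite -[in RHS](inj_eq (mulIg g)) mulgKV eq_sym.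
Qed.

Lemma young_symmetrizerE (nu : intpart n) :
  young_symmetrizer nu = delta_mx 0 (idx 1%g) *m young_op aG nu.
Proof.
rewrite young_opE /young_symmetrizer mulmx_sumr; apply: eq_bigr => a _.
rewrite mulmx_sumr; apply: eq_bigr => b _.
by rewrite -scalemxAr regular_repr_delta mul1g.
Qed.

(** The identity is the only permutation preserving both rows and columns, so
    the Young symmetrizer has coefficient 1 at the identity. *)
Lemma young_symmetrizer_neq0 (nu : intpart n) : young_symmetrizer nu != 0.
Proof.
apply/eqP => /rowP/(_ (idx 1%g)) /eqP.
rewrite mxE /young_symmetrizer summxE (bigD1 1%g) /=; last first.
  by rewrite inE; apply/forallP => i; rewrite perm1.
rewrite summxE (bigD1 1%g) /=; last first.
  by rewrite inE; apply/forallP => i; rewrite perm1.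
rewrite !mxE odd_perm1 mulg1 !eqxx expr0 mul1r.
have only1 a b : a \in row_stab nu -> b \in col_stab nu ->
    ((a * b)%g == 1%g) -> a = 1%g /\ b = 1%g.
  rewrite !inE => /forallP ra /forallP cb /eqP ab.
  have b1 : b = 1%g.
    apply/permP => i; rewrite perm1; apply: (@reshape_inj n nu); last first.
      by apply/eqP.
    have /eqP := ra (b i); have -> : a = (b^-1)%g by apply/eqP; rewrite eq_mulgV1 invgK ab.
    by rewrite permK.
  by split=> //; rewrite -ab b1 mulg1.
have coef (a b : 'S_n) : a \in row_stab nu -> b \in col_stab nu -> (a != 1%g) || (b != 1%g) ->
    ((-1) ^+ odd_perm b *: delta_mx 0 (idx (a * b)%g) : 'rV[rat]_#|G|) 0 (idx 1%g) = 0.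
  move=> ra cb ab1; rewrite !mxE eqxx /=.
  rewrite (inj_in_eq (can_in_inj (@gring_indexK _ G))) ?inE // eq_sym.
  case: eqP => [/eqP /(only1 _ _ ra cb)[a1 b1]|]; last by rewrite mulr0.
  by rewrite a1 b1 eqxx in ab1.
rewrite big1 => [|b /andP[cb b1]]; last first.
  apply: coef => //; last by rewrite b1 orbT.
  by rewrite inE; apply/forallP => i; rewrite perm1.
rewrite big1 ?addr0 => [|a /andP[ra a1]]; last first.
  by rewrite summxE big1 // => b cb; apply: coef => //; rewrite a1.
by rewrite oner_eq0.
Qed.

(** The Specht module of [la] is spanned by the translates of its Young
    symmetrizer, so these detect whether an operator vanishes on it. *)
Lemma young_op_specht0 (la mu : intpart n) :
  (young_op (specht la) mu == 0) =
  [forall g : 'S_n, young_symmetrizer la *m aG g *m young_op aG mu == 0].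
Proof.
set U := cyclic_mx aG (young_symmetrizer la).
set modU := cyclic_mx_module aG (young_symmetrizer la).
have valJ k (W : 'M_(k, \rank U)) :
    val_submod (W *m young_op (specht la) mu) = val_submod W *m young_op aG mu.
  rewrite !young_opE !mulmx_sumr linear_sum; apply: eq_bigr => a _.
  rewrite !mulmx_sumr linear_sum; apply: eq_bigr => b _.
  rewrite -!scalemxAr linearZ /=; congr (_ *: _).
  by apply: (val_submodJ modU); rewrite inE.
apply/eqP/forallP => [z g|z].
  have gU : (young_symmetrizer la *m aG g <= U)%MS.
    by apply/cyclic_mxP; exists (aG g); rewrite ?envelop_mx_id ?inE.
  by rewrite -(in_submodK gU) -valJ z mulmx0 val_submodE mul0mx.
apply/eqP; rewrite -(val_submod_eq0 (U := U)) -[young_op _ _]mul1mx valJ.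
rewrite -submx0 (eqmxMr _ (eqmx_trans (val_submod1 U) (genmxE _))) submx0; apply/eqP/row_matrixP=> i.
rewrite row0 !row_mul mul_rV_lin1 /= rowK mxvecK.
by apply/eqP/z.
Qed.

Lemma mul_tr_neq0 m (v : 'rV[rat]_m) : v != 0 -> v *m v^T != 0.
Proof.
apply: contraNneq => /matrixP/(_ 0 0); rewrite !mxE => /eqP.
rewrite psumr_eq0 => [/allP v0|j _]; last by rewrite mxE -expr2 sqr_ge0.
apply/eqP/rowP => j; rewrite mxE; have := v0 j; rewrite mem_index_enum => /(_ isT).
by rewrite /= mxE mulf_eq0 orbb => /eqP.
Qed.

Lemma tr_young_op (nu : intpart n) : (young_op aG nu)^T =
  \sum_(a in row_stab nu) \sum_(b in col_stab nu) (-1) ^+ odd_perm b *: aG (a * b)^-1%g.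
Proof.
rewrite young_opE linear_sum; apply: eq_bigr => a _.
rewrite linear_sum; apply: eq_bigr => b _.
by rewrite linearZ /= tr_regular_repr.
Qed.

(** Over the rationals the antiautomorphism inverting group elements is
    positive: if [c'] denotes the image of the symmetrizer [c], the coefficient
    of [x x'] at the identity is the sum of squares of the coefficients of [x].
    Hence [c c'] and then [(c c') (c c')'], which is [c c' c c'], are nonzero,
    so [c] does not kill the element [c c'] of the Specht module. *)
Lemma young_op_specht_neq0 (nu : intpart n) : young_op (specht nu) nu != 0.
Proof.
rewrite young_op_specht0; apply/negP => /forallP z.
set c := young_symmetrizer nu in z *; pose d : 'rV[rat]_#|G| := delta_mx 0 (idx 1%g).
have [M defM] : {M | M = young_op aG nu} by exists (young_op aG nu).
have cE : c = d *m M by rewrite defM -young_symmetrizerE.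
have nz1 : c *m M^T != 0.
  have := mul_tr_neq0 (young_symmetrizer_neq0 nu).
  by rewrite -/c {2}cE trmx_mul mulmxA; apply: contraNneq => ->; rewrite mul0mx.
have /eqP := mul_tr_neq0 nz1; apply.
rewrite [in X in _ *m X]cE !trmx_mul trmxK !mulmxA.
suff -> : c *m M^T *m M = 0 by rewrite !mul0mx.
rewrite defM tr_young_op mulmx_sumr mulmx_suml big1 // => a _.
rewrite mulmx_sumr mulmx_suml big1 // => b _.
by rewrite -scalemxAr -scalemxAl (eqP (z _)) scaler0.
Qed.

Lemma young_rank_specht (la mu : intpart n) :
  (0 < young_rank mu (specht la))%N = (la == mu).
Proof.
rewrite lt0n mxrank_eq0; have [->|neq] := eqVneq la mu.
  by rewrite young_op_specht_neq0.
apply/negbTE; rewrite negbK young_op_specht0; apply/forallP => g.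
by rewrite young_symmetrizerE -2!(mulmxA (delta_mx _ _)) young_op_orth // mulmx0.
Qed.

End RegularRepresentation.

(** The multiplicity of [specht nu] is the rank of the Young symmetrizer of
    [nu], divided by its positive rank on [specht nu]. *)
Lemma leq_specht_mult n (A B : intpart n -> nat)
    (VA := \big[dadd_grepr/grepr0]_(nu : intpart n) muln_grepr (specht nu) (A nu))
    (VB := \big[dadd_grepr/grepr0]_(nu : intpart n) muln_grepr (specht nu) (B nu))
    (T : 'M_(rdegree VA, rdegree VB)) :
  row_full T -> (forall g : 'S_n, T *m VB g = VA g *m T) ->
  forall nu, (B nu <= A nu)%N.
Proof.
move=> fullT TJ nu; have := young_rank_epi nu fullT TJ.
have rk C : young_rank nu (\big[dadd_grepr/grepr0]_la muln_grepr (specht la) (C la)) =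
    (C nu * young_rank nu (specht nu))%N.
  rewrite young_rank_sum (bigD1 nu) //= big1 ?addn0 => [|la neq].
    exact: young_rank_muln.
  rewrite young_rank_muln; apply/eqP; rewrite muln_eq0; apply/orP; right.
  by rewrite -leqn0 leqNgt young_rank_specht.
by rewrite !rk leq_pmul2r // young_rank_specht.
Qed.

Local Open Scope quotient_scope.

(** * Surjections between quotient rings *)

Section QuotientSurjection.
Variables (n : nat) (gens1 gens2 : {mpoly rat[n]} -> Prop).
Hypothesis gens12 : forall p, gens1 p -> gens2 p.
Hypothesis gens1J : forall (g : 'S_n) p, gens1 p -> gens1 (msym g p).
Hypothesis gens2J : forall (g : 'S_n) p, gens2 p -> gens2 (msym g p).

(** The canonical map between the quotients by nested ideals. *)
Definition quo_map (x : quo gens1) : quo gens2 := \pi_(quo gens2) (repr x).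

Lemma quo_map_pi p : quo_map (\pi_(quo gens1) p) = \pi_(quo gens2) p.
Proof.
apply/quo_eqP.
have /asboolP[r rG E] : repr (\pi_(quo gens1) p) - p \in ideal_gen gens1.
  exact/quo_eqP/reprK.
by apply/asboolP; exists r => // x /rG/gens12.
Qed.

Lemma quo_map_is_additive : {morph quo_map : x y / x - y}.
Proof.
by elim/quotW => p; elim/quotW => q; rewrite -raddfB !quo_map_pi raddfB.
Qed.

Lemma quo_map_is_scalable : scalable quo_map.
Proof.
have piZ (gens : {mpoly rat[n]} -> Prop) c p :
    c *: \pi_(quo gens) p = \pi_(quo gens) (c *: p).
  exact: quo_scale_pi.
by move=> c; elim/quotW => p; rewrite piZ [LHS]quo_map_pi [in RHS]quo_map_pi piZ.
Qed.

HB.instance Definition _ :=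
  GRing.isZmodMorphism.Build (quo gens1) (quo gens2) quo_map quo_map_is_additive.
HB.instance Definition _ :=
  GRing.isScalable.Build rat (quo gens1) (quo gens2) *:%R quo_map quo_map_is_scalable.

Lemma quo_map_act (g : 'S_n) x : quo_map (quo_act g x) = quo_act g (quo_map x).
Proof.
elim/quotW: x => p; rewrite quo_act_pi; last exact: gens1J.
by rewrite !quo_map_pi quo_act_pi //; apply: gens2J.
Qed.

(** Each homogeneous component of the first quotient surjects equivariantly
    onto that of the second, since both are images of homogeneous polynomials;
    [T] is the matrix of this surjection. *)
Lemma deg_iso_epi d (V1 V2 : representation rat [set: 'S_n]%G) :
    deg_iso gens1 d V1 -> deg_iso gens2 d V2 ->
  exists2 T : 'M_(rdegree V1, rdegree V2),
    row_full T & forall g : 'S_n, T *m V2 g = V1 g *m T.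
Proof.
move=> [f1 [_ im1 f1J]] [f2 [inj2 im2 f2J]].
have ex v : exists w, quo_map (f1 v) = f2 w.
  have /im1[p hp Ep] : exists w, f1 v = f1 w by exists v.
  by apply/im2; exists p => //; rewrite Ep quo_map_pi.
have [T0 T0E] := choice (fun i => ex (delta_mx 0 i)).
pose T := \matrix_i T0 i.
have TE v : f2 (v *m T) = quo_map (f1 v).
  rewrite mulmx_sum_row [v in RHS]row_sum_delta !linear_sum /=.
  by apply: eq_bigr => i _; rewrite rowK !linearZ /= -T0E.
exists T => [|g].
  rewrite -sub1mx; apply/row_subP => i.
  have /im2[p hp Ep] : exists w, f2 (row i 1%:M) = f2 w by exists (row i 1%:M).
  have /im1[v Ev] : quo_deg d (\pi_(quo gens1) p) by exists p.
  have -> : row i 1%:M = v *m T by apply: inj2; rewrite TE -Ev quo_map_pi.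
  exact: submxMl.
apply/row_matrixP => i; rewrite !rowE !mulmxA; apply: inj2.
by rewrite f2J !TE f1J quo_map_act.
Qed.

End QuotientSurjection.

(** * Comparison of the ideals *)

Lemma gens_nls_sub (n s : nat) (la mu : seq nat) :
    (forall m, tail_cols n m la <= tail_cols n m mu)%N ->
  forall p, @gens_nls n la s p -> @gens_nls n mu s p.
Proof.
move=> le_tail p [[i ->]|[S [d [d1 Sd ->]]]]; [by left; exists i|right].
by exists S, d; split=> //; apply: leq_trans Sd _; rewrite leq_add2l.
Qed.

Lemma leq_tail_cols (n h k m : nat) (la : intpart h) (mu : intpart k) :
    (h <= k <= n)%N -> dom_le la mu \/ part_incl la mu ->
  (tail_cols n m la <= tail_cols n m mu)%N.
Proof.
move=> /andP[lehk lekn] la_mu; rewrite !tail_colsE.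
- case: la_mu; last exact: part_incl_sum_excess.
  exact/dom_le_sum_excess/intpart_sorted.
- by move=> x /intpart_bound/leq_trans; apply.
by move=> x /intpart_bound/leq_trans; apply; apply: leq_trans lekn.
Qed.

Theorem theorem3p20 (n h k s : nat) (la : intpart h) (mu : intpart k)
  (h_gt0 : (0 < h)%N) (le_hk : (h <= k)%N) (le_kn : (k <= n)%N)
  (s_gt0 : (0 < s)%N)
  (size_la : (size la <= s)%N) (size_mu : (size mu <= s)%N)
  (la_mu : (h = k /\ dom_le la mu) \/ ((h < k)%N /\ part_incl la mu))
  (Fla Fmu : intpart n -> {poly nat})
  (FlaP : is_Frobq_R n la s Fla)
  (FmuP : is_Frobq_R n mu s Fmu) :
  forall (nu : intpart n) (d : nat), (((Fmu nu)`_d)%R <= ((Fla nu)`_d)%R)%N.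
Proof.
move=> nu d.
have sub p : @gens_nls n la s p -> @gens_nls n mu s p.
  apply: gens_nls_sub => m; apply: leq_tail_cols; first exact/andP.
  by case: la_mu => -[_]; [left|right].
have [T fullT TJ] := deg_iso_epi sub (@gens_nls_msym n la s)
  (@gens_nls_msym n mu s) (FlaP d) (FmuP d).
exact: (leq_specht_mult (A := fun nu => (Fla nu)`_d) (B := fun nu => (Fmu nu)`_d) fullT TJ).
Qed.
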